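(* Assume the function family $\{f_i\}$ used in the interactive protocol described in the context is claw-free. Then for any classical (non-uniform probabilistic polynomial-time) prover, the acceptance probabilities $p_x$ and $p_{\mathrm{CHSH}}$ obey $$p_x + 4\,p_{\mathrm{CHSH}} - 4 < \epsilon(n),$$ where $\epsilon$ is a negligible function of $n$, the length of the function family's input strings.
   Context: Functions. $\{f_i : X_i\to Y_i\}_{i\in I}$ is a family of efficiently computable two-to-one functions (every element of the image of $f_i$ has exactly two preimages), with $X_i\subseteq\{0,1\}^n$, where $n$ also serves (up to polynomial relation) as security parameter. An efficient probabilistic algorithm $\mathsf{Gen}$ samples an index $i$ with trapdoor data $t$; given $t$ and any $y\in Y_i$ one can efficiently compute the two preimages of $y$, or determine that $y$ is not in the image. The family is claw-free if for every non-uniform probabilistic polynomial-time classical algorithm $\mathcal A$ there is a negligible function $\eta$ such that $\Pr[f_i(x_0)=f_i(x_1)\wedge x_0\neq x_1 : (x_0,x_1)\leftarrow\mathcal A(i)]<\eta(n)$, the probability being over $i$ sampled by $\mathsf{Gen}$ and the coins of $\mathcal A$. A function $\epsilon$ is negligible if it is eventually smaller than $1/p(n)$ for every polynomial $p$. For $a,b\in\{0,1\}^n$, $a\cdot b=\sum_j a_jb_j\bmod 2$. Protocol between the verifier and a classical prover (all messages are classical strings). Round 1. The verifier samples $(i,t)\leftarrow\mathsf{Gen}$ and sends $i$; the prover replies with a string $y$. If $y$ is in the image of $f_i$, the verifier uses $t$ to compute its two preimages $x_0\neq x_1$; if $y$ is not in the image, the verifier does not accept. The verifier then randomly chooses one of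 two cases. Case A. The verifier requests a preimage; the prover replies with a string $x$. The verifier accepts iff $x\in X_i$ and $f_i(x)=y$. The probability of acceptance in this case is $p_x$. Case B. The verifier sends a uniformly random $r\in\{0,1\}^n$; the prover replies with $d\in\{0,1\}^n$. The verifier then sends a uniformly random $\theta\in\{\pi/4,-\pi/4\}$; the prover replies with a bit $m$. The verifier computes the single-qubit state, up to normalization and global phase, $|\phi\rangle\propto(-1)^{d\cdot x_0}|r\cdot x_0\rangle+(-1)^{d\cdot x_1}|r\cdot x_1\rangle$. If $r\cdot x_0=r\cdot x_1$, then $|\phi\rangle$ is taken to be $|r\cdot x_0\rangle$; otherwise $|\phi\rangle$ is $|+\rangle$ if $d\cdot x_0= d\cdot x_1$ and $|-\rangle$ if $d\cdot x_0\neq d\cdot x_1$, where $|\pm\rangle=(|0\rangle\pm|1\rangle)/\sqrt2$. The verifier accepts iff $m$ is the more likely outcome (the one with probability $\cos^2(\pi/8)$) of measuring $|\phi\rangle$ in the basis where outcome $0$ is $\cos(\theta/2)|0\rangle+\sin(\theta/2)|1\rangle$ and outcome $1$ is $-\sin(\theta/2)|0\rangle+\cos(\theta/2)|1\rangle$. Explicitly, the accepted bit is: for $|0\rangle$, $0$ for both $\theta$; for $|1\rangle$, $1$ for both $\theta$; for $|+\rangle$, $0$ if $\theta=\pi/4$ and $1$ if $\theta=-\pi/4$; for $|-\rangle$, $1$ if $\theta=\pi/4$ and $0$ if $\theta=-\pi/4$. The probability of acceptance in this case is $p_{\mathrm{CHSH}}$. The prover does not know in advance which case is chosen. Probabilities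 are over all randomness of $\mathsf{Gen}$, the verifier and the prover; $p_x$ and $p_{\mathrm{CHSH}}$ are functions of $n$. *)

(* Defs.v *)
From HB Require Import structures.
From mathcomp Require Import all_boot all_order all_algebra.
From mathcomp Require Import all_classical all_reals topology normedtype
  sequences trigo.
From mathcomp Require Import ring lra.

Set Implicit Arguments.
Unset Strict Implicit.
Unset Printing Implicit Defensive.

Import Order.TTheory GRing.Theory Num.Theory.

Local Open Scope ring_scope.

Notation bits n := (n.-tuple bool).

Definition bits_fst (a b : nat) (s : bits (a + b)) : bits a :=
  [tuple tnth s (lshift b j) | j < a].

Definition bits_snd (a b : nat) (s : bits (a + b)) : bits b :=
  [tuple tnth s (rshift a j) | j < b].

Definition dot (n : nat) (a b : bits n) : bool :=
  \big[addb/false]_(j < n) (tnth a j && tnth b j).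

(* Uniform probability on a finite nonempty type. *)
Definition Pr (R : realType) (T : finType) (E : pred T) : R :=
  #|E|%:R / #|T|%:R.

Definition poly_bounded (s : nat -> nat) : Prop :=
  exists p : {poly nat}, forall n : nat, (s n <= p.[n])%N.

(* Polynomials that are not eventually positive are excluded, as [1 / p] is
   then not a meaningful bound. *)
Definition negligible (R : realType) (e : nat -> R) : Prop :=
  forall p : {poly R},
    (\forall n \near \oo%classic, 0 < p.[n%:R]) ->
    \forall n \near \oo%classic, e n < 1 / p.[n%:R].

(* Boolean circuits as straight-line programs: the wires are the input bits
   followed by the values of the gates, in order, and a gate refers to earlier
   wires by position.  A reference to a wire that does not exist reads
   [false]. *)
Inductive gate : Type :=
  | GConst of bool
  | GNot of nat
  | GAnd of nat & nat
  | GOr of nat & nat.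

Definition gate_val (w : seq bool) (g : gate) : bool :=
  match g with
  | GConst b => b
  | GNot j => ~~ nth false w j
  | GAnd j k => nth false w j && nth false w k
  | GOr j k => nth false w j || nth false w k
  end.

Record circuit (a b : nat) : Type := Circuit {
  gates : seq gate;
  outputs : b.-tuple nat
}.

Definition wires (a b : nat) (C : circuit a b) (x : bits a) : seq bool :=
  foldl (fun w g => rcons w (gate_val w g)) x (gates C).

Definition run (a b : nat) (C : circuit a b) (x : bits a) : bits b :=
  [tuple of map (nth false (wires C x)) (outputs C)].

(* Input and output wires are counted, so that a family of circuits of
   polynomial size also has polynomially many inputs (in particular, coins). *)
Definition circuit_size (a b : nat) (C : circuit a b) : nat :=
  (a + size (gates C) + b)%N.

(* [efficient C]: [C] is a family of circuits of polynomial size, the model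
   used here for non-uniform polynomial-time algorithms.  A probabilistic
   algorithm takes uniformly random bits, its coins, as the last part of its
   input. *)
Definition efficient (a b : nat -> nat) (C : forall n, circuit (a n) (b n)) :
    Prop :=
  poly_bounded (fun n => circuit_size (C n)).

(* For each [n], a family of two-to-one functions [fn i : Xdom i -> Ycod i]
   indexed by [i \in Idx n], with [Xdom i] a set of strings of length [n].  The
   values of [fn i] outside [Xdom i] are irrelevant. *)
Record trapdoor_family : Type := TrapdoorFamily {
  ilen : nat -> nat;
  tlen : nat -> nat;
  ylen : nat -> nat;
  gcoins : nat -> nat;

  Idx : forall n, {set bits (ilen n)};
  Xdom : forall n, bits (ilen n) -> {set bits n};
  Ycod : forall n, bits (ilen n) -> {set bits (ylen n)};
  fn : forall n, bits (ilen n) -> bits n -> bits (ylen n);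

  f_codomain : forall n (i : bits (ilen n)), i \in Idx n ->
    {in Xdom i, forall x, fn i x \in Ycod i};
  f_two_to_one : forall n (i : bits (ilen n)), i \in Idx n ->
    {in Xdom i, forall x, #|[set x' in Xdom i | fn i x' == fn i x]| = 2%N};

  Eval : forall n, circuit (ilen n + n) (ylen n);
  Eval_efficient : efficient Eval;
  EvalP : forall n (i : bits (ilen n)), i \in Idx n ->
    {in Xdom i, forall x, run (Eval n) (cat_tuple i x) = fn i x};

  (* On coins [w], the output of [Gen] is the index [i] followed by the
     trapdoor [t]. *)
  Gen : forall n, circuit (gcoins n) (ilen n + tlen n);
  Gen_efficient : efficient Gen;
  Gen_index : forall n (w : bits (gcoins n)),
    bits_fst (run (Gen n) w) \in Idx n;

  (* On input [(i, t)] and [y], the first output bit tells whether [y] is in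
     the image of [fn i]; if so, the other bits are its two preimages. *)
  Inv : forall n, circuit ((ilen n + tlen n) + ylen n) (1 + (n + n));
  Inv_efficient : efficient Inv;
  InvP : forall n (w : bits (gcoins n)) (y : bits (ylen n)),
    let i := bits_fst (run (Gen n) w) in
    let out := run (Inv n) (cat_tuple (run (Gen n) w) y) in
    let x0 := bits_fst (bits_snd out) in
    let x1 := bits_snd (bits_snd out) in
    y \in Ycod i ->
    if y \in [set fn i x | x in Xdom i]
    then tnth (bits_fst out) ord0
         /\ [/\ x0 \in Xdom i, x1 \in Xdom i, x0 != x1,
               fn i x0 = y & fn i x1 = y]
    else ~~ tnth (bits_fst out) ord0
}.

Section Protocol.

Variables (R : realType) (F : trapdoor_family).

Definition gen_index (n : nat) (w : bits (gcoins F n)) : bits (ilen F n) :=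
  bits_fst (run (Gen F n) w).

Definition in_image (n : nat) (i : bits (ilen F n)) (y : bits (ylen F n)) :
    bool :=
  y \in [set fn i x | x in Xdom i].

Definition preimages (n : nat) (w : bits (gcoins F n)) (y : bits (ylen F n)) :
    bits n * bits n :=
  let out := run (Inv F n) (cat_tuple (run (Gen F n) w) y) in
  (bits_fst (bits_snd out), bits_snd (bits_snd out)).

Record claw_finder : Type := ClawFinder {
  acoins : nat -> nat;
  find_claw : forall n, circuit (ilen F n + acoins n) (n + n);
  find_claw_efficient : efficient find_claw
}.

Definition is_claw (n : nat) (i : bits (ilen F n)) (x0 x1 : bits n) : bool :=
  [&& x0 \in Xdom i, x1 \in Xdom i, fn i x0 == fn i x1 & x0 != x1].

Definition claw_prob (A : claw_finder) (n : nat) : R :=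
  Pr R [pred s : bits (gcoins F n) * bits (acoins A n) |
    let i := gen_index s.1 in
    let out := run (find_claw A n) (cat_tuple i s.2) in
    is_claw i (bits_fst out) (bits_snd out)].

Definition claw_free : Prop :=
  forall A : claw_finder,
    exists2 eta : nat -> R, negligible eta & forall n, claw_prob A n < eta n.

(* A classical prover, given by its next-message functions: each reply is
   computed from the prover's random tape, sampled once, and all the messages
   received so far.  The last input bit of [reply_m] encodes [theta], see
   [angle]. *)
Record prover : Type := Prover {
  pcoins : nat -> nat;
  reply_y : forall n, circuit (ilen F n + pcoins n) (ylen F n);
  reply_x : forall n, circuit (ilen F n + pcoins n) n;
  reply_d : forall n, circuit (ilen F n + pcoins n + n) n;
  reply_m : forall n, circuit (ilen F n + pcoins n + n + 1) 1;
  reply_y_efficient : efficient reply_y;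
  reply_x_efficient : efficient reply_x;
  reply_d_efficient : efficient reply_d;
  reply_m_efficient : efficient reply_m
}.

Definition angle (c : bool) : R := if c then - (pi / 4) else pi / 4.

Definition ket (b : bool) : 'cV[R]_2 := delta_mx (if b then 1 else 0) 0.

(* Up to normalization; all amplitudes in the protocol are real. *)
Definition phi (n : nat) (r d x0 x1 : bits n) : 'cV[R]_2 :=
  if dot r x0 == dot r x1 then ket (dot r x0)
  else (-1) ^+ dot d x0 *: ket (dot r x0) + (-1) ^+ dot d x1 *: ket (dot r x1).

Definition basis_vec (theta : R) (m : bool) : 'cV[R]_2 :=
  if m then - sin (theta / 2) *: ket false + cos (theta / 2) *: ket true
  else cos (theta / 2) *: ket false + sin (theta / 2) *: ket true.

Definition inner (u v : 'cV[R]_2) : R := (u^T *m v) 0 0.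

Definition outcome_prob (v : 'cV[R]_2) (theta : R) (m : bool) : R :=
  inner (basis_vec theta m) v ^+ 2 / inner v v.

Definition more_likely (v : 'cV[R]_2) (theta : R) (m : bool) : bool :=
  outcome_prob v theta (~~ m) < outcome_prob v theta m.

Definition accept_x (P : prover) (n : nat)
    (w : bits (gcoins F n)) (c : bits (pcoins P n)) : bool :=
  let i := gen_index w in
  let y := run (reply_y P n) (cat_tuple i c) in
  let x := run (reply_x P n) (cat_tuple i c) in
  [&& in_image i y, x \in Xdom i & fn i x == y].

Definition accept_CHSH (P : prover) (n : nat)
    (w : bits (gcoins F n)) (c : bits (pcoins P n))
    (r : bits n) (theta : bool) : bool :=
  let i := gen_index w in
  let y := run (reply_y P n) (cat_tuple i c) in
  let d := run (reply_d P n) (cat_tuple (cat_tuple i c) r) in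
  let m := tnth (run (reply_m P n)
                  (cat_tuple (cat_tuple (cat_tuple i c) r) [tuple theta])) ord0 in
  let: (x0, x1) := preimages w y in
  in_image i y && more_likely (phi r d x0 x1) (angle theta) m.

Definition p_x (P : prover) (n : nat) : R :=
  Pr R [pred s : bits (gcoins F n) * bits (pcoins P n) | accept_x s.1 s.2].

Definition p_CHSH (P : prover) (n : nat) : R :=
  Pr R [pred s : bits (gcoins F n) * bits (pcoins P n) * bits n * bool |
    accept_CHSH s.1.1.1 s.1.1.2 s.1.2 s.2].

Lemma innerE u v : inner u v = u 0 0 * v 0 0 + u 1 0 * v 1 0.
Proof.
rewrite /inner mxE !big_ord_recl big_ord0 !mxE addr0.
by congr (_ + u _ _ * v _ _); apply/val_inj.
Qed.

Lemma cos_sin_pi8 :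
  [/\ 0 < sin (pi / 8) :> R, sin (pi / 8) < cos (pi / 8) :> R
    & cos (pi / 8) ^+ 2 - sin (pi / 8) ^+ 2
      = 2 * (cos (pi / 8) * sin (pi / 8)) :> R].
Proof.
have pi0 := pi_gt0 R; set a : R := pi / 8.
have s0 : 0 < sin a by apply: sin_gt0_pihalf; rewrite /a; lra.
have c0 : 0 < cos a by apply: cos_gt0_pihalf; rewrite /a; lra.
have e1 : cos (a *+ 2) = sin (a *+ 2).
  rewrite -[LHS]opprK -sinBpihalf -sinN; congr sin.
  by rewrite /a mulr2n; lra.
have e2 : cos a ^+ 2 - sin a ^+ 2 = 2 * (cos a * sin a).
  have := e1; rewrite cos_mulr2n sin_mulr2n !mulr2n.
  have := cos2Dsin2 a; set cc := cos a ^+ 2; set ss := sin a ^+ 2.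
  by set cs := cos a * sin a; lra.
split=> //.
rewrite -subr_gt0 -(pmulr_lgt0 _ (addr_gt0 c0 s0)) -subr_sqr e2.
by rewrite !mulr_gt0.
Qed.

(* The accepted bit: for [|0>] and [|1>] it is [0] and [1] for both angles; for
   [|+>] it is [0] at [pi / 4] and [1] at [- pi / 4]; for [|->] the opposite. *)
Definition accepted_bit (n : nat) (r d x0 x1 : bits n) (theta : bool) : bool :=
  if dot r x0 == dot r x1 then dot r x0
  else (dot d x0 != dot d x1) (+) theta.

Lemma outcome_prob_phiE n (r d x0 x1 : bits n) (theta m : bool) :
  outcome_prob (phi r d x0 x1) (angle theta) m =
  if m == accepted_bit r d x0 x1 theta then cos (pi / 8) ^+ 2
  else sin (pi / 8) ^+ 2.
Proof.
have [_ _ e] := cos_sin_pi8; have cs1 := cos2Dsin2 (pi / 8 : R).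
rewrite /outcome_prob /phi /accepted_bit !innerE /angle /basis_vec.
have -> : (if theta then - (pi / 4) else pi / 4) / 2 =
          (-1) ^+ theta * (pi / 8) :> R by case: theta => /=; field.
have -> : cos ((-1) ^+ theta * (pi / 8)) = cos (pi / 8) :> R.
  by case: theta; rewrite /= ?expr0 ?expr1 ?mul1r ?mulN1r ?cosN.
have -> : sin ((-1) ^+ theta * (pi / 8)) = (-1) ^+ theta * sin (pi / 8) :> R.
  by case: theta; rewrite /= ?expr0 ?expr1 ?mul1r ?mulN1r ?sinN.
move: e cs1; set c := cos _; set s := sin _ => e cs1.
case: (dot r x0); case: (dot r x1); case: (dot d x0); case: (dot d x1);
  case: theta; case: m; rewrite /= ?expr0 ?expr1 !mxE /=;
  (apply: canLR (mulfK _) _; [apply/eqP => h|]; lra).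
Qed.

Lemma more_likely_phiE n (r d x0 x1 : bits n) (theta m : bool) :
  more_likely (phi r d x0 x1) (angle theta) m =
  (m == accepted_bit r d x0 x1 theta).
Proof.
have [s0 sc _] := cos_sin_pi8; rewrite /more_likely !outcome_prob_phiE.
have lt : sin (pi / 8) ^+ 2 < cos (pi / 8) ^+ 2 :> R.
  by rewrite ltr_pXn2r ?nnegrE // ltW // (lt_trans s0).
by case: m (accepted_bit _ _ _ _ _) => -[]; rewrite /= ?lt // ltNge ltW.
Qed.

End Protocol.

(* Main.v *)
(** Play the prover up to its answers [m] for both angles, on the same tape and
    the same string [r].  The two accepted bits differ exactly when
    [r . x0 <> r . x1], so if both answers are accepted then their sum is
    [r . s], where [s = x0 + x1].  By the union bound over the angle this
    happens on average with probability at least [2 p_CHSH - 1] over [r], and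
    [p_x + 4 p_CHSH - 4 = (p_x - 1) + (2 (2 p_CHSH - 1) - 1)].  If this is not
    negligible then, with non-negligible probability over the index and the
    tape, the prover returns a preimage [x] while [r . s] is predicted with a
    non-negligible advantage over 1/2.  The Goldreich-Levin decoder then
    recovers [s]: for a random matrix [V] with logarithmically many rows and a
    guess of [V s], the bit [s_k] is a majority vote of the predictions at
    [J V + e_k] corrected by [J (V s)], over all row vectors [J].  The output
    [(x, x + s)] is a claw. *)

Require Import Defs.
From mathcomp Require Import all_boot all_order all_algebra.
From mathcomp Require Import all_classical all_reals.
From mathcomp Require Import topology normedtype sequences.
From mathcomp Require Import zify ring lra.

Set Implicit Arguments.
Unset Strict Implicit.
Unset Printing Implicit Defensive.

Import Order.TTheory GRing.Theory Num.Theory.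

Local Open Scope ring_scope.

(** * Circuits as derivations of sets of wire functions *)

Section Derives.

Local Open Scope classical_set_scope.

Variable a : nat.
Implicit Types (f : bits a -> bool) (S : set (bits a -> bool)).

Definition eval_gates (gs : seq gate) (w : seq bool) : seq bool :=
  foldl (fun w g => rcons w (gate_val w g)) w gs.

Lemma size_eval_gates gs w : size (eval_gates gs w) = (size w + size gs)%N.
Proof. by elim: gs w => [|g gs IH] w /=; rewrite ?addn0 // IH size_rcons addSnnS. Qed.

Lemma eval_gates_cat gs1 gs2 w :
  eval_gates (gs1 ++ gs2) w = eval_gates gs2 (eval_gates gs1 w).
Proof. exact: foldl_cat. Qed.

Lemma nth_eval_gates gs w j :
  (j < size w)%N -> nth false (eval_gates gs w) j = nth false w j.
Proof.
elim: gs w => [|g gs IH] w //= jw.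
by rewrite IH ?size_rcons ?leqW // nth_rcons jw.
Qed.

(** The bound on [j] keeps the wire stable: a reference past the end reads [false] now but may hit a
    gate appended later. *)
Definition on_wire (gs : seq gate) f : Prop :=
  exists2 j, (j < a + size gs)%N &
    forall x : bits a, nth false (eval_gates gs x) j = f x.

Lemma on_wire_cat gs1 gs2 f : on_wire gs1 f -> on_wire (gs1 ++ gs2) f.
Proof.
move=> [j jlt jf]; exists j; first by rewrite size_cat addnA ltn_addr.
by move=> x; rewrite eval_gates_cat nth_eval_gates // size_eval_gates size_tuple.
Qed.

(* At most [s] gates, added to any circuit that has all of [S] on its wires,
   put all of [S'] on wires. *)
Definition derives (s : nat) S S' : Prop :=
  forall gs, (forall f, S f -> on_wire gs f) ->
    exists2 ext, (size ext <= s)%N & forall f, S' f -> on_wire (gs ++ ext) f.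

Lemma derives_sub s S S' : S' `<=` S -> derives s S S'.
Proof. by move=> sub gs H; exists [::] => // f /sub /H; rewrite cats0. Qed.

Lemma derivesW S1 S s1 s2 S' :
  S1 `<=` S -> (s1 <= s2)%N -> derives s1 S1 S' -> derives s2 S S'.
Proof.
move=> sub le12 D gs H; have [f /sub /H //|ext le1 D'] := D gs.
by exists ext => //; apply: leq_trans le12.
Qed.

Lemma derives_cut S S1 S2 s1 s2 :
  derives s1 S S1 -> derives s2 (S `|` S1) S2 -> derives (s1 + s2) S S2.
Proof.
move=> D1 D2 gs H; have [e1 le1 H1] := D1 gs H.
have [f [/H/on_wire_cat|/H1]//|e2 le2 H2] := D2 (gs ++ e1).
by exists (e1 ++ e2); rewrite ?size_cat ?leq_add // catA.
Qed.

Lemma derives_setU S S1 S2 s1 s2 :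
  derives s1 S S1 -> derives s2 S S2 -> derives (s1 + s2) S (S1 `|` S2).
Proof.
move=> D1 D2 gs H; have [e1 le1 H1] := D1 gs H.
have [f /H/on_wire_cat//|e2 le2 H2] := D2 (gs ++ e1).
exists (e1 ++ e2); rewrite ?size_cat ?leq_add // catA.
by move=> f [/H1/on_wire_cat|/H2].
Qed.

Lemma derives_range (I : finType) (F : I -> bits a -> bool) S s :
  (forall i, derives s S [set F i]) -> derives (#|I| * s) S (range F).
Proof.
move=> D; rewrite cardE.
suff Dr r : derives (size r * s) S [set F i | i in [set` r]].
  move=> gs /(Dr (enum I)) [e le_e He]; exists e => // _ [i _ <-].
  by apply: He; exists i => //=; rewrite mem_enum.
elim: r => [|i r IH]; first by apply: derives_sub => f [].
move=> gs /(derives_setU (D i) IH) [e le_e He]; exists e; first by rewrite mulSn.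
move=> _ [k /= + <-]; rewrite inE => /predU1P[->|kr]; apply: He; first by left.
by right; exists k.
Qed.

(** The gate is chosen after [gs], since the positions of its operands depend on [gs]. *)
Lemma derives_gate S f :
  (forall gs, (forall f, S f -> on_wire gs f) ->
     exists g, forall x : bits a, gate_val (eval_gates gs x) g = f x) ->
  derives 1 S [set f].
Proof.
move=> fP gs /fP[g gf]; exists [:: g] => // _ ->.
exists (a + size gs)%N; first by rewrite size_cat addnA addn1 leqnn.
move=> x; rewrite eval_gates_cat /= nth_rcons size_eval_gates size_tuple.
by rewrite ltnn eqxx gf.
Qed.

Lemma derives_const S b : derives 1 S [set fun=> b].
Proof. by apply: derives_gate => gs _; exists (GConst b). Qed.

Lemma derives_neg S f s :
  derives s S [set f] -> derives s.+1 S [set fun x => ~~ f x].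
Proof.
rewrite -addn1 => /derives_cut; apply; apply: derives_gate => gs H.
have [|j _ jf] := H f; first by right.
by exists (GNot j) => x /=; rewrite jf.
Qed.

Lemma derives_and S f f' s s' :
  derives s S [set f] -> derives s' S [set f'] ->
  derives (s + s').+1 S [set fun x => f x && f' x].
Proof.
move=> D D'; rewrite -addn1; apply: derives_cut (derives_setU D D') _.
apply: derives_gate => gs H.
have [|j _ jf] := H f; first by right; left.
have [|j' _ jf'] := H f'; first by right; right.
by exists (GAnd j j') => x /=; rewrite jf jf'.
Qed.

Lemma derives_or S f f' s s' :
  derives s S [set f] -> derives s' S [set f'] ->
  derives (s + s').+1 S [set fun x => f x || f' x].
Proof.
move=> D D'; rewrite -addn1; apply: derives_cut (derives_setU D D') _.
apply: derives_gate => gs H.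
have [|j _ jf] := H f; first by right; left.
have [|j' _ jf'] := H f'; first by right; right.
by exists (GOr j j') => x /=; rewrite jf jf'.
Qed.

(** The 4 counts one or, two ands and a negation. *)
Lemma derives_addb S f f' s s' :
  derives s S [set f] -> derives s' S [set f'] ->
  derives (s + s' + 4) S [set fun x => f x (+) f' x].
Proof.
move=> D D'; rewrite (_ : (fun x => f x (+) f' x) =
  fun x => (f x || f' x) && ~~ (f x && f' x)); last first.
  by apply/funext => x; case: (f x) (f' x) => -[].
apply: derivesW (derives_cut (derives_setU D D') _) => //.
have Df : derives 0 (S `|` ([set f] `|` [set f'])) [set f].
  by apply: derives_sub => _ ->; right; left.
have Df' : derives 0 (S `|` ([set f] `|` [set f'])) [set f'].
  by apply: derives_sub => _ ->; right; right.
exact: (derivesW (fun=> id) _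
  (derives_and (derives_or Df Df') (derives_neg (derives_and Df Df')))).
Qed.

(** The sum is in [bool] as the field with two elements, an iterated exclusive or; the extra gate is
    the empty sum. *)
Lemma derives_sum S (I : finType) (F : I -> bits a -> bool) s :
  (forall i, derives s S [set F i]) ->
  derives (#|I| * (s + 4)).+1 S [set fun x => \sum_i F i x].
Proof.
move=> D; rewrite cardE (_ : (fun x => _) = fun x => \sum_(i <- enum I) F i x).
  elim: (enum I) => [|i r IH].
    rewrite (_ : (fun x => _) = fun=> false); first exact: derives_const.
    by apply/funext => x; rewrite big_nil.
  rewrite (_ : (fun x => _) = fun x => F i x (+) \sum_(i <- r) F i x).
    by apply: derivesW (derives_addb (D i) IH) => //=; lia.
  by apply/funext => x; rewrite big_cons.
by apply/funext => x; rewrite big_enum.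
Qed.

(* Counting in unary, one vote at a time. *)
Lemma derives_threshold S (I : Type) (r : seq I) (F : I -> bits a -> bool) s k :
  (forall i, derives s S [set F i]) ->
  derives (k.+1 + size r * (s + 2 * k.+1)) S
    [set fun x => k <= count (F^~ x) r]%N.
Proof.
move=> D; pose thr r (j : 'I_k.+1) (x : bits a) := (j <= count (F^~ x) r)%N.
suff Dr r' : derives (k.+1 + size r' * (s + 2 * k.+1)) S (range (thr r')).
  by move=> gs /(Dr r)[e le_e He]; exists e => // _ ->; apply: He; exists ord_max.
elim: r' => [|i r' IH].
  apply: derivesW (derives_range (S := S) (s := 1) _) => //.
    by rewrite card_ord; lia.
  move=> j; rewrite (_ : thr [::] j = fun=> j == 0 :> nat) ?leqn0 //.
    exact: derives_const.
  by apply/funext => x; rewrite /thr /= leqn0.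
have D2 := derives_setU (D i) IH.
apply: derivesW (derives_cut D2 (derives_range (s := 2) _)) => //.
  by rewrite card_ord /=; lia.
move=> j.
(* For [j = 0] the predecessor is [0] again, which is harmless since that threshold is always
   met. *)
have jk : (j.-1 < k.+1)%N by rewrite (leq_ltn_trans (leq_pred _)).
rewrite (_ : thr (i :: r') j =
    fun x => thr r' j x || F i x && thr r' (Ordinal jk) x).
  apply: (@derives_or _ _ _ 0 1).
    by apply: derives_sub => _ ->; right; right; exists j.
  apply: (@derives_and _ _ _ 0 0); apply: derives_sub => _ ->; right.
    by left.
  by right; exists (Ordinal jk).
by apply/funext => x; rewrite /thr /=; case: (F i x) => /=; lia.
Qed.

(** The gates of [C] are replayed on the wires of [h]. The extra gate is a constant [false], read
    wherever [C] refers to a wire that does not exist. *)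
Lemma derives_run (b c : nat) (C : circuit b c) (h : bits a -> bits b) S s :
  derives s S (range (fun j x => tnth (h x) j)) ->
  derives (s + (size (gates C)).+1) S
    (range (fun k x => tnth (run C (h x)) k)).
Proof.
case: C => gs out /= D; apply: (derives_cut D).
set S' := _ `|` _.
suff {D} Dg : derives (size gs).+1 S'
    (range (fun j x => nth false (eval_gates gs (h x)) j)).
  move=> gs' /Dg[e le_e He]; exists e => // _ [k _ <-].
  apply: He; exists (tnth out k) => //.
  by apply/funext => x; rewrite tnth_map.
elim/last_ind: gs => [|gs g IH].
  move=> gs H; have [e le_e He] := @derives_const S' false gs H.
  exists e => // _ [j _ <-].
  have [jb|bj] := ltnP j b.
    apply: on_wire_cat; apply: H; right; exists (Ordinal jb) => //.
    by apply/funext => x; rewrite /= (tnth_nth false).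
  apply: He; apply/funext => x /=; rewrite nth_default //.
  by rewrite size_tuple.
have Dg : derives 1 (S' `|` range (fun j x => nth false (eval_gates gs (h x)) j))
    [set fun x => gate_val (eval_gates gs (h x)) g].
  apply: derives_gate => gs' H.
  have W j : exists j', forall x : bits a,
      nth false (eval_gates gs' x) j' = nth false (eval_gates gs (h x)) j.
    by have [|j' _ ?] := H (fun x => nth false (eval_gates gs (h x)) j);
      [right; exists j|exists j'].
  case: g => [v|j|j j'|j j'].
  - by exists (GConst v).
  - by have [k jk] := W j; exists (GNot k) => x /=; rewrite jk.
  - have [k jk] := W j; have [k' jk'] := W j'.
    by exists (GAnd k k') => x /=; rewrite jk jk'.
  - have [k jk] := W j; have [k' jk'] := W j'.
    by exists (GOr k k') => x /=; rewrite jk jk'.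
rewrite size_rcons -addn1; apply: derives_cut IH _.
move=> gs' /(derives_setU (derives_sub 0 (@subset_refl _ _)) Dg)[e le_e He].
exists e => // _ [j _ <-].
have [->|jn] := eqVneq j (b + size gs)%N.
  apply: He; right; apply/funext => x.
  rewrite -cats1 eval_gates_cat /= nth_rcons size_eval_gates size_tuple.
  by rewrite ltnn eqxx.
apply: He; left; right; exists j => //; apply/funext => x.
rewrite -cats1 eval_gates_cat /= nth_rcons size_eval_gates size_tuple (negPf jn).
by case: ltnP => // le; rewrite nth_default // size_eval_gates size_tuple.
Qed.

Lemma derives_circuit (b : nat) (f : bits a -> bits b) s :
  derives s (range (fun j x => tnth x j)) (range (fun k x => tnth (f x) k)) ->
  exists2 C : circuit a b, (size (gates C) <= s)%N & run C =1 f.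
Proof.
move=> /(_ [::])[f' [j _ <-]|gs le_gs H].
  by exists j; rewrite ?addn0 // => x; rewrite (tnth_nth false).
have {}H k : exists j, forall x : bits a, nth false (eval_gates gs x) j = tnth (f x) k.
  by have [|j _ jf] := H (fun x => tnth (f x) k); [exists k|exists j].
have [out outP] := choice H.
exists (Circuit a gs [tuple out k | k < b]) => // x.
by apply: eq_from_tnth => k; rewrite tnth_map tnth_mktuple outP.
Qed.

End Derives.

(** * Majority votes over the row span of a random matrix *)

Section Votes.

Variable R : realType.

(** Pick a coordinate where [J] and [J'] differ. Adding [b] to that row of [V] fixes one product and
    translates the other by [b]; averaging over [b] leaves the factor [\sum_r k r = 0]. *)
Lemma sum_mulmx_uncorrelated (t n : nat) (k : 'rV[bool]_n -> R) (J J' : 'rV[bool]_t) :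
  \sum_r k r = 0 -> J != J' ->
  \sum_(V : 'M[bool]_(t, n)) k (J *m V) * k (J' *m V) = 0.
Proof.
move=> k0; wlog [j Jj J'j] : J J' / exists2 j, J 0 j = false & J' 0 j = true.
  move=> sep neq; have /rV0Pn[j] : J - J' != 0 by rewrite subr_eq0.
  rewrite !mxE subr_eq0 => Jj.
  case E : (J 0 j) Jj; case E' : (J' 0 j) => // _.
    under eq_bigr do rewrite mulrC.
    by apply: sep; rewrite 1?eq_sym //; exists j.
  by apply: sep => //; exists j.
move=> _; set X := \sum_V _.
have shiftE (b : 'rV[bool]_n) :
    X = \sum_(V : 'M[bool]_(t, n)) k (J *m V) * k (J' *m V + b).
  rewrite /X (reindex_inj (addIr (delta_mx j 0 *m b))) /=.
  apply: eq_bigr => V _; rewrite !mulmxDr !mulmxA.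
  have dj (L : 'rV[bool]_t) : L *m delta_mx j (0 : 'I_1) = (L 0 j)%:M.
    by rewrite -colE; apply/matrixP => x y; rewrite !mxE !ord1 eqxx.
  by rewrite !dj Jj J'j !mul_scalar_mx scale0r scale1r addr0.
have cardX : #|{: 'rV[bool]_n}|%:R * X = 0.
  rewrite mulr_natl -sumr_const; under eq_bigr => b _ do rewrite (shiftE b).
  rewrite exchange_big big1 // => V _; rewrite -mulr_sumr.
  by move: k0; rewrite (reindex_inj (addrI (J' *m V))) /= => ->; rewrite mulr0.
move/eqP: cardX; rewrite mulf_eq0 pnatr_eq0 card_mx card_bool mul1n.
by rewrite expn_eq0 /= => /eqP.
Qed.

(* Chebyshev's inequality: the points [J *m V] are pairwise uncorrelated.  The
   constant [4] is wasteful, but it lets [J = 0] take part in the vote. *)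
Lemma card_lost_votes (t n : nat) (h : 'rV[bool]_n -> R) (e : R) :
  (forall r, `|h r| <= 1) -> 0 <= e -> e * #|{: 'rV[bool]_n}|%:R <= \sum_r h r ->
  #|[set V : 'M[bool]_(t, n) | \sum_J h (J *m V) <= 0]|%:R * ((2 ^ t)%:R * e ^+ 2)
    <= 4 * #|{: 'M[bool]_(t, n)}|%:R.
Proof.
move=> h1 e0 he; set N : R := #|{: 'rV[bool]_n}|%:R in he.
have N0 : 0 < N by rewrite ltr0n card_mx expn_gt0 card_bool.
(* Centering gives the zero sum needed for uncorrelatedness. Both [h] and [m] are at most 1 in
   absolute value, so the square of [k] is at most 4. *)
pose m := (\sum_r h r) / N; pose k r := h r - m.
have em : e <= m by rewrite ler_pdivlMr.
have m1 : `|m| <= 1.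
  rewrite normrM normfV (gtr0_norm N0) ler_pdivrMr // mul1r.
  apply: le_trans (ler_norm_sum _ _ _) _.
  by rewrite /N -sumr_const; apply: ler_sum.
have k2 r : k r ^+ 2 <= 4.
  have : `|k r| <= 2 by apply: le_trans (ler_normB _ _) _; have := h1 r; lra.
  by rewrite -(ler_pXn2r (n := 2)) ?nnegrE // real_normK ?num_real //; lra.
have k0 : \sum_r k r = 0.
  by rewrite /k sumrB sumr_const -[m *+ _]mulr_natr divfK ?subrr // gt_eqF.
set M : R := (2 ^ t)%:R.
have cardJ : #|{: 'rV[bool]_t}|%:R = M by rewrite card_mx card_bool mul1n.
have M0 : 0 < M by rewrite ltr0n expn_gt0.
(* Only the [2 ^ t] diagonal terms survive, each at most 4 per matrix. *)
have second_moment : \sum_(V : 'M[bool]_(t, n)) (\sum_J k (J *m V)) ^+ 2 <=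
    4 * M * #|{: 'M[bool]_(t, n)}|%:R.
  under eq_bigr => V _ do rewrite expr2 mulr_suml;
    under eq_bigr => V _ do under eq_bigr => J _ do rewrite mulr_sumr.
  rewrite exchange_big /=; under eq_bigr => J _ do rewrite exchange_big /=.
  rewrite -cardJ (mulrC 4) -mulrA mulr_natl -sumr_const; apply: ler_sum => J _.
  rewrite (bigD1 J) //= [X in _ + X]big1 ?addr0; last first.
    by move=> J' neq; apply: sum_mulmx_uncorrelated; rewrite // eq_sym.
  by rewrite mulr_natr -sumr_const; apply: ler_sum => V _; rewrite -expr2.
rewrite -(ler_pM2l M0) (mulrCA M 4) (mulrA 4); apply: le_trans second_moment.
set B := [set _ | _].
have -> : M * (#|B|%:R * (M * e ^+ 2)) = #|B|%:R * (M * e) ^+ 2 by ring.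
rewrite mulr_natl -sumr_const big_mkcond.
apply: ler_sum => V _; rewrite inE; case: ifP => [hV|_]; last exact: sqr_ge0.
(* A lost vote puts the centered sum at or below [- M * m], so its square is at least
   [(M * e) ^+ 2]. *)
have -> : \sum_J k (J *m V) = \sum_J h (J *m V) - M * m.
  by rewrite /k sumrB sumr_const -[m *+ _]mulr_natl cardJ.
rewrite -[leRHS]sqrrN ler_pXn2r ?nnegrE //.
- by have := ler_wpM2l (ltW M0) em; lra.
- by rewrite mulr_ge0 // ltW.
- by have := ler_wpM2l (ltW M0) (le_trans e0 em); lra.
Qed.

End Votes.

(** * The claw finder *)

Section Finder.

Variables (L pc n t : nat) (Cx : circuit (L + pc) n)
  (Cm : circuit (L + pc + n + 1) 1).

Definition row_bits (r : 'rV[bool]_n) : bits n := [tuple r 0 l | l < n].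

(* When both answers are the accepted ones, their sum is [r . (x0 + x1)]. *)
Definition xor_oracle (i : bits L) (c : bits pc) (r : bits n) : bool :=
  let m theta := tnth (run Cm (cat_tuple (cat_tuple (cat_tuple i c) r)
                                 [tuple theta])) ord0 in
  m false (+) m true.

Local Notation ncoins := (pc + (t * n + t))%N.

(** The finder's coins are the prover's tape, then the [t * n] entries of the matrix [V], then [t]
    bits guessing [V *m s]. *)
Definition prover_tape (z : bits ncoins) : bits pc := bits_fst z.

Definition seeds (z : bits ncoins) : 'M[bool]_(t, n) :=
  \matrix_(j, l) tnth (bits_fst (bits_snd z)) (mxvec_index j l).

Definition labels (z : bits ncoins) : 'cV[bool]_t :=
  \col_j tnth (bits_snd (bits_snd z)) j.

Definition vote (i : bits L) (z : bits ncoins) (k : 'I_n) (J : 'rV[bool]_t) :=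
  xor_oracle i (prover_tape z) (row_bits (J *m seeds z + delta_mx 0 k))
    (+) (J *m labels z) 0 0.

Definition xor_guess (i : bits L) (z : bits ncoins) (k : 'I_n) : bool :=
  ((2 ^ t)./2 < count (vote i z k) (enum 'rV[bool]_t))%N.

Definition claw_guess (i : bits L) (z : bits ncoins) : bits (n + n) :=
  let x := run Cx (cat_tuple i (prover_tape z)) in
  cat_tuple x [tuple tnth x k (+) xor_guess i z k | k < n].

Definition pack (c : bits pc) (V : 'M[bool]_(t, n)) (b : 'cV[bool]_t) :
    bits ncoins :=
  cat_tuple c (cat_tuple [tuple mxvec V 0 k | k < t * n] [tuple b j 0 | j < t]).

Lemma bits_fst_cat (p q : nat) (u : bits p) (v : bits q) :
  bits_fst (cat_tuple u v) = u.
Proof. by apply: eq_from_tnth => j; rewrite tnth_mktuple tnth_lshift. Qed.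

Lemma bits_snd_cat (p q : nat) (u : bits p) (v : bits q) :
  bits_snd (cat_tuple u v) = v.
Proof. by apply: eq_from_tnth => j; rewrite tnth_mktuple tnth_rshift. Qed.

Lemma prover_tape_pack c V b : prover_tape (pack c V b) = c.
Proof. exact: bits_fst_cat. Qed.

Lemma seeds_pack c V b : seeds (pack c V b) = V.
Proof.
apply/matrixP => j l.
by rewrite mxE /pack bits_snd_cat bits_fst_cat tnth_mktuple mxvecE.
Qed.

Lemma labels_pack c V b : labels (pack c V b) = b.
Proof.
apply/matrixP => j l.
by rewrite mxE /pack !bits_snd_cat tnth_mktuple ord1.
Qed.

(** With the correct labels [V *m s], a vote equals [s k 0] exactly when the oracle is right at
    [J *m V + delta_mx 0 k]; a positive sum of signs says that the right predictions are a strict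
    majority. *)
Lemma xor_guessE (R : realType) i c V (s : 'cV[bool]_n) k
    (h := fun r : 'rV[bool]_n =>
       if xor_oracle i c (row_bits r) == (r *m s) 0 0 then 1 else -1 : R) :
  0 < \sum_J h (J *m V + delta_mx 0 k) ->
  xor_guess i (pack c V (V *m s)) k = s k 0.
Proof.
pose ok J := xor_oracle i c (row_bits (J *m V + delta_mx 0 k)) ==
  ((J *m V + delta_mx 0 k) *m s) 0 0.
have voteE J : vote i (pack c V (V *m s)) k J = ~~ ok J (+) s k 0.
  rewrite /vote prover_tape_pack seeds_pack labels_pack mulmxA.
  have -> : (J *m V *m s) 0 0 = ((J *m V + delta_mx 0 k) *m s) 0 0 (+) s k 0.
    by rewrite mulmxDl [in RHS]mxE -rowE [row k s 0 0]mxE addbK.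
  rewrite /ok; case: (xor_oracle _ _ _) => /=; case: (s k 0);
    by case: ((_ *m s) 0 0).
have card_ok : (count ok (enum 'rV[bool]_t) +
    count (predC ok) (enum 'rV[bool]_t) = 2 ^ t)%N.
  by rewrite count_predC -cardE card_mx card_bool mul1n.
have -> : \sum_J h (J *m V + delta_mx 0 k) =
    (count ok (enum 'rV[bool]_t))%:R - (count (predC ok) (enum 'rV[bool]_t))%:R.
  rewrite -[LHS]big_enum /=; elim: (enum _) => [|J r IH].
    by rewrite big_nil subrr.
  rewrite big_cons IH /= /h -/(ok J) !natrD.
  by case: (ok J) => /=; ring.
rewrite subr_gt0 ltr_nat /xor_guess (eq_count voteE) => lt.
have -> : count (fun J => ~~ ok J (+) s k 0) (enum 'rV[bool]_t) =
   if s k 0 then count ok (enum 'rV[bool]_t) else count (predC ok) (enum 'rV[bool]_t).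
  by case: (s k 0); apply: eq_count => J /=; case: (ok J).
case: (s k 0); lia.
Qed.

End Finder.

(** * Size of a circuit for the claw finder *)

Section FinderCircuit.

Local Open Scope classical_set_scope.

Variables (L pc n t : nat) (Cx : circuit (L + pc) n)
  (Cm : circuit (L + pc + n + 1) 1).

Local Notation ncoins := (pc + (t * n + t))%N.
Local Notation input := (bits (L + ncoins)).
Local Notation input_wires :=
  (range (fun j (x : input) => tnth x j)).
Local Notation index x := (bits_fst x).
Local Notation coins x := (bits_snd x).

Lemma wires_bits_fst (a b c : nat) S (f : bits a -> bits (b + c)) :
  range (fun j x => tnth (f x) j) `<=` S ->
  range (fun j x => tnth (bits_fst (f x)) j) `<=` S.
Proof.
move=> H _ [j _ <-]; apply: H; exists (lshift c j) => //.
by apply/funext => x; rewrite tnth_mktuple.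
Qed.

Lemma wires_bits_snd (a b c : nat) S (f : bits a -> bits (b + c)) :
  range (fun j x => tnth (f x) j) `<=` S ->
  range (fun j x => tnth (bits_snd (f x)) j) `<=` S.
Proof.
move=> H _ [j _ <-]; apply: H; exists (rshift b j) => //.
by apply/funext => x; rewrite tnth_mktuple.
Qed.

Lemma derives_cat_tuple (a b c s s' : nat) S (f : bits a -> bits b)
    (g : bits a -> bits c) :
  derives s S (range (fun j x => tnth (f x) j)) ->
  derives s' S (range (fun j x => tnth (g x) j)) ->
  derives (s + s') S (range (fun j x => tnth (cat_tuple (f x) (g x)) j)).
Proof.
move=> Df Dg gs /(derives_setU Df Dg)[e le_e He]; exists e => // _ [j _ <-].
apply: He; case: (split_ordP j) => k ->; [left|right]; exists k => //.
  by apply/funext => x; rewrite tnth_lshift.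
by apply/funext => x; rewrite tnth_rshift.
Qed.

Lemma derives_mem (a : nat) (S : set (bits a -> bool)) f :
  S f -> derives 0 S [set f].
Proof. by move=> Sf; apply: derives_sub => _ ->. Qed.

Lemma derives_const_mul (a : nat) (S : set (bits a -> bool)) b f :
  S f -> derives 1 S [set fun x => b * f x].
Proof.
move=> Sf; case: b; last exact: derives_const.
by apply: derivesW (derives_mem Sf) => //.
Qed.

Lemma index_wires : range (fun j (x : input) => tnth (index x) j) `<=` input_wires.
Proof. by apply: (wires_bits_fst (f := id)); exact: subset_refl. Qed.

Lemma tape_wires :
  range (fun j (x : input) => tnth (prover_tape (coins x)) j) `<=` input_wires.
Proof.
by apply: (wires_bits_fst (wires_bits_snd (f := id) _)); exact: subset_refl.
Qed.

(** [J] and [k] are hardwired, so each coordinate is an affine form in the seed wires: 5 gates per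
    row of [V], and 6 for the empty sum, the constant and the last exclusive or. *)
Lemma derives_point (J : 'rV[bool]_t) k :
  derives (n * (t * 5 + 6)) input_wires
    (range (fun l x => tnth (row_bits (J *m seeds (coins x) + delta_mx 0 k)) l)).
Proof.
apply: derivesW (derives_range (S := input_wires) (s := t * 5 + 6) _) => //.
  by rewrite card_ord.
move=> l.
rewrite (_ : (fun x => _) = fun x => (\sum_j J 0 j * seeds (coins x) j l) (+)
    (delta_mx 0 k : 'rV[bool]_n) 0 l).
  have Dsum : derives (#|'I_t| * (1 + 4)).+1 input_wires
      [set fun x => \sum_j J 0 j * seeds (coins x) j l].
    apply: derives_sum => j; apply: derives_const_mul.
    apply: (wires_bits_fst (wires_bits_snd (wires_bits_snd (f := id) _))).
      exact: subset_refl.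
    by exists (mxvec_index j l) => //; apply/funext => x; rewrite mxE.
  apply: derivesW (derives_addb Dsum (derives_const _)) => //.
  by rewrite card_ord; lia.
by apply/funext => x; rewrite tnth_mktuple !mxE.
Qed.

Definition vote_cost := (2 * (n * (t * 5 + 6) + size (gates Cm)) + 5 * t + 20)%N.

(** The circuit [Cm] is copied once per angle, both copies at the same point; [vote_cost] is rounded
    up. *)
Lemma derives_vote J k :
  derives vote_cost input_wires
    [set fun x => vote Cm (index x) (coins x) k J].
Proof.
have derives_m (theta : bool) :
  derives (n * (t * 5 + 6) + 1 + (size (gates Cm)).+1) input_wires
    [set fun x => tnth (run Cm (cat_tuple (cat_tuple (cat_tuple (index x)
       (prover_tape (coins x))) (row_bits (J *m seeds (coins x) + delta_mx 0 k)))
       [tuple theta])) ord0].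
  have Dtheta : derives 1 input_wires
      (range (fun (j : 'I_1) (x : input) => tnth [tuple theta] j)).
    apply: derivesW (derives_range (S := input_wires) (s := 1) _) => //.
      by rewrite card_ord.
    by move=> j; apply: derives_const.
  have Di := derives_sub 0 index_wires; have Dc := derives_sub 0 tape_wires.
  have D := derives_run Cm (derives_cat_tuple (derives_cat_tuple
    (derives_cat_tuple Di Dc) (derives_point J k)) Dtheta).
  by move=> gs /D[e le_e He]; exists e => // _ ->; apply: He; exists ord0.
rewrite (_ : (fun x => _) = fun x => (xor_oracle Cm (index x)
    (prover_tape (coins x)) (row_bits (J *m seeds (coins x) + delta_mx 0 k))) (+)
    (\sum_j J 0 j * labels (coins x) j 0)); last first.
  by apply/funext => x; rewrite /vote mxE.
have Dsum : derives (#|'I_t| * (1 + 4)).+1 input_wires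
    [set fun x => \sum_j J 0 j * labels (coins x) j 0].
  apply: derives_sum => j; apply: derives_const_mul.
  apply: (wires_bits_snd (wires_bits_snd (wires_bits_snd (f := id) _))).
    exact: subset_refl.
  by exists j => //; apply/funext => x; rewrite mxE.
apply: derivesW (derives_addb (derives_addb (derives_m false) (derives_m true))
  Dsum) => //.
by rewrite card_ord /vote_cost; lia.
Qed.

(** [Cx] is copied [n.+1] times: for the first half of the output and for each bit of the second.
    The size is exponential in [t] only, which will be logarithmic. *)
Definition finder_cost :=
  (n.+1 * ((size (gates Cx)).+1 + 2 ^ t + 7 + 2 ^ t * (vote_cost + 2 * 2 ^ t + 4)))%N.

Lemma claw_guess_circuit : exists2 C : circuit (L + ncoins) (n + n),
  (size (gates C) <= finder_cost)%N &
  forall i z, run C (cat_tuple i z) = claw_guess Cx Cm i z.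
Proof.
have Dx : derives (size (gates Cx)).+1 input_wires (range (fun k x =>
    tnth (run Cx (cat_tuple (index x) (prover_tape (coins x)))) k)).
  apply: (@derives_run _ _ _ Cx _ _ 0).
  exact: (derives_cat_tuple (derives_sub 0 index_wires) (derives_sub 0 tape_wires)).
pose cg := ((2 ^ t)./2.+2 + size (enum 'rV[bool]_t) *
  (vote_cost + 2 * (2 ^ t)./2.+2))%N.
have Dg k : derives cg input_wires
    [set fun x => xor_guess Cm (index x) (coins x) k].
  exact: (@derives_threshold _ _ _ (enum 'rV[bool]_t) _ _ (2 ^ t)./2.+1
    (fun J => derives_vote J k)).
have Ds : derives (#|'I_n| * ((size (gates Cx)).+1 + cg + 4)) input_wires
  (range (fun (k : 'I_n) x =>
    tnth [tuple tnth (run Cx (cat_tuple (index x) (prover_tape (coins x)))) k (+)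
      xor_guess Cm (index x) (coins x) k | k < n] k)).
  apply: derives_range => k.
  rewrite (_ : (fun x => _) = fun x =>
    tnth (run Cx (cat_tuple (index x) (prover_tape (coins x)))) k (+)
      xor_guess Cm (index x) (coins x) k).
    apply: derives_addb (Dg k) => gs /Dx[e le_e He].
    by exists e; [exact: le_e|move=> _ ->; apply: He; exists k].
  by apply/funext => x; rewrite tnth_mktuple.
have D : derives finder_cost input_wires (range (fun k x =>
    tnth (claw_guess Cx Cm (index x) (coins x)) k)).
  apply: derivesW (derives_cat_tuple Dx Ds) => //.
  rewrite /cg card_ord -cardE card_mx card_bool mul1n /finder_cost.
  have : ((2 ^ t)./2.*2 <= 2 ^ t)%N by rewrite -[leqRHS]odd_double_half leq_addl.
  move: (2 ^ t)%N vote_cost (size _) => M v sx leM.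
  rewrite (mulSn n); apply: leq_add; first by rewrite -!addnA leq_addr.
  rewrite leq_mul2l; apply/orP; right.
  rewrite -!addnA leq_add2l.
  have : (M * (v + 2 * (M./2).+2) <= M * (v + 2 * M + 4))%N.
    by rewrite leq_mul2l; apply/orP; right; lia.
  lia.
have [C le_C runC] := derives_circuit D.
exists C => // i z.
by rewrite runC bits_fst_cat bits_snd_cat.
Qed.

End FinderCircuit.

(** * Success probability of the claw finder *)

Section Reduction.

Variables (R : realType) (F : trapdoor_family) (P : prover F) (n t : nat).

Local Notation prover_state := (bits (gcoins F n) * bits (pcoins P n))%type.

Definition shift (u : prover_state) : 'cV[bool]_n :=
  let y := run (reply_y P n) (cat_tuple (gen_index u.1) u.2) in
  let: (x0, x1) := preimages u.1 y in \col_l (tnth x0 l (+) tnth x1 l).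

(** Signs make the mean over [r] the advantage, twice the probability of a correct prediction minus
    1. *)
Definition agreement (u : prover_state) (r : 'rV[bool]_n) : R :=
  if xor_oracle (reply_m P n) (gen_index u.1) u.2 (row_bits r)
     == (r *m shift u) 0 0 then 1 else -1.

Definition promising (e : R) (u : prover_state) : bool :=
  accept_x u.1 u.2 && (e * #|{: 'rV[bool]_n}|%:R <= \sum_r agreement u r).

Lemma norm_agreement u r : `|agreement u r| = 1.
Proof. by rewrite /agreement; case: ifP; rewrite ?normrN normr1. Qed.

Lemma row_bits_bij : bijective (@row_bits n).
Proof.
exists (fun r : bits n => \row_l tnth r l).
  by move=> r; apply/rowP => l; rewrite mxE tnth_mktuple.
by move=> r; apply: eq_from_tnth => l; rewrite tnth_mktuple mxE.
Qed.

Lemma dot_row_bits (r : 'rV[bool]_n) (x : bits n) :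
  dot (row_bits r) x = (r *m \col_l tnth x l) 0 0.
Proof.
rewrite mxE; apply: eq_bigr => l _.
by rewrite tnth_mktuple mxE.
Qed.

(** The right-hand side is 2 or 1. Since [d] does not depend on the angle, the accepted bits for the
    two angles sum to [r . s], so a wrong prediction means that at least one answer is rejected. *)
Lemma accept_CHSH_agreement (u : prover_state) (r : 'rV[bool]_n) :
  (accept_CHSH R u.1 u.2 (row_bits r) false)%:R +
  (accept_CHSH R u.1 u.2 (row_bits r) true)%:R <= (3 + agreement u r) / 2.
Proof.
rewrite /accept_CHSH /agreement /shift /xor_oracle.
case: (preimages _ _) => x0 x1; rewrite !more_likely_phiE.
set i := gen_index _; case: (in_image _ _) => /=; last by case: ifP => _; lra.
set m0 := tnth _ _; set m1 := tnth _ _.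
have -> : (r *m \col_l (tnth x0 l (+) tnth x1 l)) 0 0 =
    dot (row_bits r) x0 (+) dot (row_bits r) x1.
  rewrite !dot_row_bits -[RHS]/(_ + _).
  have -> : \col_l (tnth x0 l (+) tnth x1 l) =
      \col_l tnth x0 l + \col_l tnth x1 l by apply/colP => l; rewrite !mxE.
  by rewrite mulmxDr mxE.
rewrite /accepted_bit.
case: (dot (row_bits r) x0) (dot (row_bits r) x1) (dot _ x0 != dot _ x1)
  => -[] []; case: m0; case: m1 => /=; lra.
Qed.

Lemma sum_agreement_le u : \sum_r agreement u r <= #|{: 'rV[bool]_n}|%:R.
Proof.
rewrite -sumr_const; apply: ler_sum => r _.
by apply: le_trans (ler_norm _) _; rewrite norm_agreement.
Qed.

Lemma PrE (T : finType) (E : pred T) : Pr R E = (\sum_x (E x)%:R) / #|T|%:R.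
Proof.
rewrite /Pr -sum1_card natr_sum big_mkcond; congr (_ / _).
by apply: eq_bigr => x _; rewrite unfold_in; case: (E x).
Qed.

(** By [accept_CHSH_agreement], a state contributes at most its preimage acceptance plus its
    advantage minus 1. This is at most 1 always, at most [e] if the advantage is below [e], and at
    most 0 if the preimage is rejected. *)
Lemma score_le_promising (e : R) : 0 <= e ->
  p_x R P n + 4 * p_CHSH R P n - 4 <= Pr R (promising e) + e.
Proof.
move=> e0; rewrite /p_x /p_CHSH !PrE /=.
set K : R := #|{: prover_state}|%:R; set N : R := #|{: 'rV[bool]_n}|%:R.
have K0 : 0 < K.
  by rewrite ltr0n card_prod !card_tuple muln_gt0 !expn_gt0 card_bool.
have N0 : 0 < N by rewrite ltr0n card_mx expn_gt0 card_bool.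
have -> : #|{: prover_state * bits n * bool}|%:R = K * N * 2 :> R.
  by rewrite 2!card_prod !natrM card_bool card_tuple card_bool /N card_mx mul1n card_bool.
rewrite -(pair_big_dep xpredT (fun _ => xpredT)
  (fun (s : prover_state * bits n) (theta : bool) =>
  (accept_CHSH R s.1.1 s.1.2 s.2 theta)%:R)) /=.
rewrite -(pair_big_dep xpredT (fun _ => xpredT) (fun (u : prover_state) (r : bits n) =>
  \sum_theta (accept_CHSH R u.1 u.2 r theta)%:R)) /=.
rewrite -(ler_pM2r K0) mulrDl [leRHS]mulrDl divfK ?gt_eqF // mulrDl divfK ?gt_eqF //.
(* The factor 2 is 4 divided by the number of angles. *)
have -> (S : R) : 4 * (S / (K * N * 2)) * K = 2 / N * S.
  by field; rewrite !gt_eqF.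
rewrite mulr_sumr (mulrC (-4)) (mulrC e).
have cst (c : R) : K * c = \sum_(u : prover_state) c by rewrite sumr_const mulr_natl.
rewrite !cst -!big_split /=; apply: ler_sum => u _.
rewrite (reindex _ (onW_bij _ row_bits_bij)) /=.
have leH : \sum_(r : 'rV[bool]_n) \sum_theta (accept_CHSH R u.1 u.2 (row_bits r) theta)%:R
    <= (3 * N + \sum_r agreement u r) / 2.
  rewrite mulrC mulrDr mulr_sumr (_ : 2^-1 * (3 * N) = \sum_(r : 'rV[bool]_n) 3 / 2).
    rewrite -big_split; apply: ler_sum => r _.
    rewrite big_bool /= addrC; apply: le_trans (accept_CHSH_agreement u r) _.
    by lra.
  by rewrite sumr_const -mulr_natl -/N; lra.
have leN := sum_agreement_le u; rewrite -/N in leN.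
set A := \sum_(r : 'rV[bool]_n) _ in leH *.
rewrite /promising -/N; move: leH leN; set H := \sum_r agreement u r => leH leN.
rewrite -ler_pdivlMr //; have {leN} : H / N <= 1 by rewrite ler_pdivrMr ?mul1r.
have : 2 / N * A <= 3 + H / N.
  rewrite (_ : 3 + H / N = 2 / N * ((3 * N + H) / 2)); last by field; rewrite gt_eqF.
  by rewrite ler_pM2l // divr_gt0.
move: (2 / N * A) (H / N) => z x; case: (accept_x _ _) => /=; case: (leP e x) => /=; lra.
Qed.

(** By Chebyshev, the vote for a given [k] is lost on at most a fraction [4 / (2 ^ t * e ^+ 2)] of
    the matrices. With the constant 8, the union bound over the [n] bits loses at most half of
    them. *)
Lemma card_won_votes (e : R) u : 0 < e -> 8 * n%:R <= (2 ^ t)%:R * e ^+ 2 ->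
  e * #|{: 'rV[bool]_n}|%:R <= \sum_r agreement u r ->
  #|{: 'M[bool]_(t, n)}|%:R <= 2 * #|[set V : 'M[bool]_(t, n) |
    [forall k, 0 < \sum_J agreement u (J *m V + delta_mx 0 k)]]|%:R :> R.
Proof.
move=> e0 le8 hu; set W := [set V | _].
pose B k := [set V : 'M[bool]_(t, n) |
  \sum_J agreement u (J *m V + delta_mx 0 k) <= 0].
set M : R := (2 ^ t)%:R in le8 *; set C : R := #|{: 'M[bool]_(t, n)}|%:R.
have M0 : 0 < M * e ^+ 2 by rewrite mulr_gt0 ?exprn_gt0 // ltr0n expn_gt0.
have leB k : #|B k|%:R * (M * e ^+ 2) <= 4 * C.
  (* Translating by [delta_mx 0 k] does not change the sum over all points. *)
  apply: (@card_lost_votes _ _ _ (fun r => agreement u (r + delta_mx 0 k))).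
  - by move=> r; rewrite norm_agreement.
  - exact: ltW.
  - by move: hu; rewrite (reindex_inj (addIr (delta_mx 0 k))).
have cover : (#|~: W| <= \sum_k #|B k|)%N.
  under eq_bigr do rewrite -sum1_card big_mkcond.
  rewrite exchange_big -sum1_card big_mkcond leq_sum //= => V _.
  case: ifP => //; rewrite !inE negb_forall => /existsP[k].
  by rewrite -leNgt => Vk; rewrite (bigD1 k) //= inE Vk.
have leW : #|~: W|%:R * (M * e ^+ 2) <= n%:R * (4 * C).
  apply: le_trans (_ : \sum_k (#|B k|%:R * (M * e ^+ 2)) <= _).
    by rewrite -mulr_suml ler_pM2r // -natr_sum ler_nat.
  by rewrite -[n in leRHS]card_ord mulr_natl -sumr_const; apply: ler_sum.
have CE : C = #|W|%:R + #|~: W|%:R by rewrite -natrD cardsC.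
have C0 : 0 <= C by [].
suff : 2 * #|~: W|%:R <= C by lra.
rewrite -(ler_pM2r M0); nra.
Qed.

(** Winning votes with the true labels make the second output [x + x0 + x1]; as [x] is one of the
    two preimages of [y], this is the other one. *)
Lemma is_claw_claw_guess u (V : 'M[bool]_(t, n)) : accept_x u.1 u.2 ->
  (forall k, 0 < \sum_J agreement u (J *m V + delta_mx 0 k)) ->
  let out := claw_guess (reply_x P n) (reply_m P n) (gen_index u.1)
               (pack u.2 V (V *m shift u)) in
  is_claw (gen_index u.1) (bits_fst out) (bits_snd out).
Proof.
case: u => w c; rewrite /accept_x [(w, c).1]/= [(w, c).2]/=.
set i := gen_index w; set y := run (reply_y P n) _.
set x := run (reply_x P n) _ => /and3P[yim xX /eqP fx] win.
have iI : i \in Idx F n by apply: Gen_index.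
have yY : y \in Ycod i by move: yim => /imsetP[x' x'X ->]; apply: f_codomain.
have := @InvP F n w y yY; rewrite -/(gen_index w) -/i -[_ \in _]/(in_image i y) yim.
case=> _; set x0 := bits_fst (bits_snd _); set x1 := bits_snd (bits_snd _).
case=> x0X x1X x01 fx0 fx1.
rewrite /claw_guess prover_tape_pack -/i -/x bits_fst_cat bits_snd_cat.
set x' := [tuple _ | k < n].
have x'E k : tnth x' k = tnth x k (+) (tnth x0 k (+) tnth x1 k).
  by rewrite tnth_mktuple (@xor_guessE _ _ _ _ _ R) ?mxE //; apply: win.
have [xx|[-> x'x]] : x = x0 /\ x' = x1 \/ x = x1 /\ x' = x0.
  (* Both preimages lie in the fibre of [x], which has exactly two elements. *)
  have : x \in [set x0; x1].
    have sub : [set x0; x1] \subset [set z in Xdom i | fn i z == fn i x].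
      by apply/fintype.subsetP => z; rewrite !inE => /orP[] /eqP ->;
        rewrite ?x0X ?x1X fx ?fx0 ?fx1 eqxx.
    have /eqP -> : [set x0; x1] == [set z in Xdom i | fn i z == fn i x].
      by rewrite eqEcard sub (f_two_to_one iI xX) cards2 x01.
    by rewrite inE xX eqxx.
  rewrite !inE => /orP[]/eqP xE; [left|right]; split=> //; apply: eq_from_tnth => k;
    by rewrite x'E xE; case: (tnth x0 k); case: (tnth x1 k).
  by case: xx => -> ->; rewrite /is_claw x0X x1X fx0 fx1 eqxx.
by rewrite x'x /is_claw x0X x1X fx0 fx1 eqxx eq_sym.
Qed.

(** The 2 pays for the matrices that lose a vote, and [2 ^ t] for guessing the labels. *)
Lemma Pr_promising_le (e : R) : 0 < e -> 8 * n%:R <= (2 ^ t)%:R * e ^+ 2 ->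
  Pr R (promising e) <= 2 * (2 ^ t)%:R *
    Pr R [pred s : bits (gcoins F n) * bits (pcoins P n + (t * n + t)) |
      let out := claw_guess (reply_x P n) (reply_m P n) (gen_index s.1) s.2 in
      is_claw (gen_index s.1) (bits_fst out) (bits_snd out)].
Proof.
move=> e0 le8; rewrite /Pr; set Q := [pred s | _].
pose W u := [set V : 'M[bool]_(t, n) |
  [forall k, 0 < \sum_J agreement u (J *m V + delta_mx 0 k)]].
pose E := [set uV : prover_state * 'M[bool]_(t, n) |
  promising e uV.1 && (uV.2 \in W uV.1)].
(* Each state and matrix is completed by its true labels; injectivity turns this into a lower bound
   on the successful coins. *)
pose enc (uV : prover_state * 'M[bool]_(t, n)) :=
  (uV.1.1, pack uV.1.2 uV.2 (uV.2 *m shift uV.1)).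
have encI : injective enc.
  apply: (can_inj (g := fun s => ((s.1, prover_tape s.2), seeds s.2))).
  by case=> [[w c] V]; rewrite /= prover_tape_pack seeds_pack.
have leEQ : (#|E| <= #|Q|)%N.
  rewrite -(card_imset _ encI).
  apply/subset_leq_card/fintype.subsetP => _ /imsetP[[u V] + ->].
  rewrite inE /= => /andP[/andP[ux _]]; rewrite inE => /forallP win.
  by rewrite unfold_in /=; apply: is_claw_claw_guess.
have leE : #|promising e|%:R * #|{: 'M[bool]_(t, n)}|%:R <= 2 * #|E|%:R :> R.
  have -> : #|E| = (\sum_(u | promising e u) #|W u|)%N.
    rewrite -sum1_card; under [RHS]eq_bigr do rewrite -sum1_card.
    by rewrite pair_big_dep /=; apply: eq_bigl => -[u V]; rewrite !inE.
  rewrite natr_sum mulr_sumr mulr_natl -sumr_const; apply: ler_sum => u /andP[_].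
  exact: card_won_votes.
rewrite 2!card_prod !card_tuple card_bool !expnD !natrM.
set K : R := (2 ^ gcoins F n)%:R; set L : R := (2 ^ pcoins P n)%:R.
have K0 : 0 < K by rewrite ltr0n expn_gt0.
have L0 : 0 < L by rewrite ltr0n expn_gt0.
have T0 : 0 < (2 ^ t)%:R :> R by rewrite ltr0n expn_gt0.
move: leE; rewrite card_mx card_bool => leE.
have M0 : 0 < (2 ^ (t * n))%:R :> R by rewrite ltr0n expn_gt0.
set M : R := (2 ^ (t * n))%:R in leE M0 *; set T : R := (2 ^ t)%:R in T0 le8 *.
have -> : 2 * T * (#|Q|%:R / (K * (L * (M * T)))) = 2 * #|Q|%:R / M / (K * L).
  by field; rewrite !gt_eqF.
rewrite ler_pM2r ?invr_gt0 ?mulr_gt0 // ler_pdivlMr //.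
by apply: le_trans leE _; rewrite ler_pM2l // ler_nat.
Qed.

End Reduction.

(** * Asymptotics *)

Lemma poly_bounded_le (f g : nat -> nat) :
  (forall n, f n <= g n)%N -> poly_bounded g -> poly_bounded f.
Proof. by move=> le [p gp]; exists p => n; apply: leq_trans (gp n). Qed.

Lemma poly_bounded_cst (c : nat) : poly_bounded (fun=> c).
Proof. by exists c%:P => n; rewrite hornerC. Qed.

Lemma poly_bounded_id : poly_bounded id.
Proof. by exists 'X => n; rewrite hornerX. Qed.

Lemma poly_boundedD (f g : nat -> nat) :
  poly_bounded f -> poly_bounded g -> poly_bounded (fun n => f n + g n)%N.
Proof. by move=> [p fp] [q gq]; exists (p + q) => n; rewrite hornerD leq_add. Qed.

Lemma poly_boundedM (f g : nat -> nat) :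
  poly_bounded f -> poly_bounded g -> poly_bounded (fun n => f n * g n)%N.
Proof. by move=> [p fp] [q gq]; exists (p * q) => n; rewrite hornerM leq_mul. Qed.

Lemma poly_bounded_horner (p : {poly nat}) : poly_bounded (fun n => p.[n]).
Proof. by exists p. Qed.

Section Asymptotics.

Variables (R : realType) (F : trapdoor_family) (P : prover F).

(** For [e = 1 / q.[n].+1] this gives enough rows for the union bound, yet [2 ^ t] stays polynomial.
    The inner successor keeps the argument of the logarithm positive. *)
Definition votes_log (q : {poly nat}) (n : nat) : nat :=
  (trunc_log 2 (8 * n * q.[n].+1 ^ 2).+1).+1.

Lemma votes_log_bounds q n :
  (8 * n * q.[n].+1 ^ 2 <= 2 ^ votes_log q n <= 2 * (8 * n * q.[n].+1 ^ 2).+1)%N.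
Proof.
rewrite /votes_log; set m := (8 * n * _)%N.
have /andP[le lt] := trunc_log_bounds (isT : 1 < 2)%N (ltn0Sn m).
by rewrite (ltnW (ltnW lt)) expnS leq_mul2l.
Qed.

Lemma poly_bounded_exp_votes_log q : poly_bounded (fun n => 2 ^ votes_log q n)%N.
Proof.
apply: (@poly_bounded_le _ (fun n => 2 * (8 * n * (q.[n] + 1) * (q.[n] + 1) + 1))%N).
  move=> n; have /andP[_ /leq_trans] := votes_log_bounds q n; apply.
  by rewrite !addn1 -mulnn mulnA.
by by do ![apply: poly_boundedD | apply: poly_boundedM | apply: poly_bounded_cst
      | apply: poly_bounded_id | apply: poly_bounded_horner].
Qed.

(** The reduction is applied with [e = 1 / q.[n].+1], and [B n] is its loss [2 * 2 ^ t]. The finder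
    depends on [q], so each inverse polynomial is treated separately. *)
Lemma claw_finder_of_prover (q : {poly nat}) :
  exists A : claw_finder F, exists2 B : nat -> nat, poly_bounded B &
    forall n, p_x R P n + 4 * p_CHSH R P n - 4 <=
      (B n)%:R * claw_prob R A n + 1 / q.[n].+1%:R.
Proof.
pose t := votes_log q.
pose finder n := cid2 (claw_guess_circuit (t n) (reply_x P n) (reply_m P n)).
have eff : efficient (fun n => s2val (finder n)).
  have [bx bxP] := reply_x_efficient P; have [bm bmP] := reply_m_efficient P.
  have [b2 b2P] := poly_bounded_exp_votes_log q.
  apply: (@poly_bounded_le _ (fun n => bx.[n] + (b2.[n] * n + b2.[n]) + (n + 1) *
    (bx.[n] + 1 + b2.[n] + 7 + b2.[n] *
       (2 * (n * (b2.[n] * 5 + 6) + bm.[n]) + 5 * b2.[n] + 20 + 2 * b2.[n] + 4))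
    + (n + n))%N).
    move=> n; rewrite /circuit_size; case: (finder n) => C /= le_C _.
    move: (bxP n) (bmP n) (b2P n); rewrite /circuit_size -/(t n) => hx hm h2.
    (* As [t < 2 ^ t], the polynomial bound on [2 ^ t] also bounds [t]. *)
    have ht : (t n <= b2.[n])%N by rewrite (leq_trans _ h2) // ltnW // ltn_expl.
    rewrite !leq_add2r; apply: leq_add.
      rewrite addnA leq_add //; first lia.
      by rewrite leq_add // leq_mul2r ht orbT.
    apply: leq_trans le_C _; rewrite /finder_cost /vote_cost.
    rewrite [X in (_ <= X * _)%N]addn1 leq_mul2l /=.
    rewrite leq_add //; first lia.
    apply: leq_mul => //.
    have : (n * (t n * 5 + 6) <= n * (b2.[n] * 5 + 6))%N.
      by rewrite leq_mul2l leq_add2r leq_mul2r ht !orbT.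
    lia.
  by do ![apply: poly_boundedD | apply: poly_boundedM | apply: poly_bounded_cst
      | apply: poly_bounded_id | apply: poly_bounded_horner].
exists (ClawFinder eff).
exists (fun n => 2 * 2 ^ t n)%N => [|n].
  exact: poly_boundedM (poly_bounded_cst 2) (poly_bounded_exp_votes_log q).
set b : R := q.[n].+1%:R; have b0 : 0 < b by rewrite ltr0n.
have /andP[ge_t _] := votes_log_bounds q n.
have e0 : 0 < 1 / b by rewrite divr_gt0.
apply: le_trans (score_le_promising P n (ltW e0)) _; rewrite lerD2r.
have le8 : 8 * n%:R <= (2 ^ t n)%:R * (1 / b) ^+ 2.
  rewrite expr_div_n expr1n mulrA mulr1 ler_pdivlMr ?exprn_gt0 //.
  by rewrite /b -natrX -!natrM ler_nat.
apply: le_trans (Pr_promising_le P e0 le8) _.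
have -> : claw_prob R (ClawFinder eff) n =
  Pr R [pred s : bits (gcoins F n) * bits (pcoins P n + (t n * n + t n)) |
    let out := claw_guess (reply_x P n) (reply_m P n) (gen_index s.1) s.2 in
    is_claw (gen_index s.1) (bits_fst out) (bits_snd out)].
  rewrite /claw_prob /=; congr Pr; apply/funext => s /=.
  by case: (finder n) => C /= _ ->.
by rewrite natrM.
Qed.

End Asymptotics.

(** * Comparison with an arbitrary inverse polynomial *)

Lemma horner_le_nat (R : realType) (p : {poly R}) :
  exists q : {poly nat}, forall n, p.[n%:R] <= q.[n]%:R.
Proof.
exists (\poly_(i < size p) Num.bound `|p`_i|) => n.
rewrite horner_coef horner_poly natr_sum; apply: ler_sum => i _.
rewrite natrM natrX ler_wpM2r ?exprn_ge0 //.
by apply: le_trans (ler_norm _) (ltW (archi_boundP (normr_ge0 _))).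
Qed.

Theorem theorem2 (R : realType) (F : trapdoor_family)
    (hF : claw_free R F) (P : prover F) :
  exists2 epsilon : nat -> R, negligible epsilon &
    forall n : nat, p_x R P n + 4 * p_CHSH R P n - 4 < epsilon n.
Proof.
(* The required bound is strict, so a positive negligible function is added to the score itself;
   [eta0] is positive because it exceeds a probability. *)
have [A0 _] := claw_finder_of_prover R P 0.
have [eta0 eta0_negl eta0P] := hF A0.
exists (fun n => p_x R P n + 4 * p_CHSH R P n - 4 + eta0 n); last first.
  move=> n; rewrite ltrDl; apply: le_lt_trans (eta0P n).
  by rewrite divr_ge0.
move=> p p_pos.
(* The margin [1 / p] is split into three equal parts: for [eta0], for [1 / q.[n].+1] and for the
   multiple of the claw probability. *)
have [q qP] := horner_le_nat (3 * p).
have [A [B' [B leB] AB]] := claw_finder_of_prover R P q.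
have [eta eta_negl etaP] := hF A.
(* Adding 1 keeps this polynomial positive where [B] vanishes. *)
pose Br : {poly R} := (\poly_(i < size B) (B`_i)%R%:R) + 1.
have BrE n : Br.[n%:R] = B.[n]%:R + 1.
  rewrite hornerD hornerC horner_poly horner_coef natr_sum; congr (_ + _).
  by apply: eq_bigr => i _; rewrite natrM natrX.
have p3E n : (3 * p).[n%:R] = 3 * p.[n%:R].
  by rewrite mulr_natl hornerMn mulr_natl.
have pos3 : \forall n \near \oo%classic, 0 < (3 * p).[n%:R].
  near=> n; rewrite p3E mulr_gt0 //; near: n.
  exact: p_pos.
have pos3B : \forall n \near \oo%classic, 0 < (3 * p * Br).[n%:R].
  near=> n; rewrite hornerM BrE mulr_gt0 ?ltr_wpDl //; near: n.
  exact: pos3.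
have small0 := eta0_negl _ pos3; have small := eta_negl _ pos3B.
near=> n.
have p0 : 0 < p.[n%:R] by near: n.
have h0 : eta0 n < 1 / (3 * p).[n%:R] by near: n.
have h1 : eta n < 1 / (3 * p * Br).[n%:R] by near: n.
have hq : 1 / q.[n].+1%:R < 1 / (3 * p.[n%:R]) :> R.
  rewrite !div1r ltf_pV2 ?posrE ?mulr_gt0 //.
  by rewrite -p3E; apply: le_lt_trans (qP n) _; rewrite ltr_nat.
have hA : B.[n]%:R * claw_prob R A n < 1 / (3 * p.[n%:R]).
  have Br0 : 0 < B.[n]%:R + 1 :> R by rewrite ltr_wpDl.
  have c0 : 0 <= claw_prob R A n by rewrite divr_ge0.
  move: h1; rewrite hornerM BrE p3E => /(lt_trans (etaP n)).
  rewrite ltr_pdivlMr ?mulr_gt0 // => h1.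
  by rewrite ltr_pdivlMr ?mulr_gt0 //; nra.
have := AB n; have : (B' n)%:R * claw_prob R A n <= B.[n]%:R * claw_prob R A n.
  by rewrite ler_wpM2r ?ler_nat // divr_ge0.
have e3 : 3 * (1 / (3 * p.[n%:R])) = 1 / p.[n%:R].
  by field; rewrite gt_eqF.
move: h0 hq hA; rewrite p3E -e3.
move: (1 / (3 * _)) (1 / q.[n].+1%:R) (_ * claw_prob _ _ _) (_ * claw_prob _ _ _).
move=> x y z z' hx hy hz hzz.
set u := p_x _ _ _ + _ - _ => hu.
lra.
Unshelve. all: by end_near.
Qed.
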